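(* Let $q$ be a prime power and let $\mathcal{E}$ be a strongly regular $q$-ary graph with parameters $(v,k,\mu-2,\mu;q)$ and with vertex set $V$. Then the set $$\mathcal{B}_{\mathcal{E}}:=\{N_{\mathcal{E}}(X)\mid X\in V\}$$ of all neighborhoods determines a $2\text{-}(v,k+1,\mu;q)$ design with point set $V$.
   Context: A $q$-ary graph with underlying vector space $W$ over $\mathbb{F}_q$ is a pair $\mathcal{E}=(V,E)$ where $V$ is the set of all $1$-dimensional subspaces of $W$ (the vertices) and $E$ is a set of $2$-dimensional subspaces of $W$ (the edges). Two vertices $X,Y$ are adjacent if the span $\langle X,Y\rangle$ is an element of $E$ (in particular $X\neq Y$). The neighborhood $N_{\mathcal{E}}(X)$ of a vertex $X$ is the set consisting of $X$ and all vertices adjacent to $X$. A set of $1$-dimensional subspaces is identified with a subspace $U$ when it is exactly the set of all $1$-dimensional subspaces of $U$. A $q$-ary graph $\mathcal{E}$ with underlying vector space $\mathbb{F}_q^v$ is $k$-regular if for every vertex $X$ the neighborhood $N_{\mathcal{E}}(X)$ is a $(k+1)$-dimensional subspace of $\mathbb{F}_q^v$. A $k$-regular $q$-ary graph $\mathcal{E}$ with underlying vector space $\mathbb{F}_q^v$ is a strongly regular $q$-ary graph with parameters $(v,k,\lambda,\mu;q)$ if for all vertices $X\ne Y$ the number of vertices in $(N_{\mathcal{E}}(X)\cap N_{\mathcal{E}}(Y))\setminus\{X,Y\}$ equals $\lambda$ if $X$ and $Y$ are adjacent, and equals $\mu$ otherwise. A $t\text{-}(v,k,\lambda;q)$ design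 $(\mathcal{P},\mathcal{B})$ consists of the set of points $\mathcal{P}$, which is the set of all $1$-dimensional subspaces of $\mathbb{F}_q^v$, and a set $\mathcal{B}$ of $k$-dimensional subspaces of $\mathbb{F}_q^v$ (the blocks) such that every $t$-dimensional subspace $T$ of $\mathbb{F}_q^v$ is contained in exactly $\lambda$ elements of $\mathcal{B}$.
   Formalization: For v ≥ 2 the complete graph is excluded from the claim about the set of neighborhoods (there it has one block, yet μ = [v]_q ≥ 3 is allowed); for every graph the claim is proved with neighborhoods counted with multiplicity. *)

(* Defs.v *)
From HB Require Import structures.
From mathcomp Require Import all_boot all_order all_algebra.
Set Implicit Arguments.
Unset Strict Implicit.
Unset Printing Implicit Defensive.

Import GRing.Theory.
Local Open Scope ring_scope.

HB.instance Definition _ (F : finFieldType) (W : vectType F) :=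
  Countable.copy {vspace W} (can_type (@VectorInternalTheory.vs2mxK F W)).
HB.instance Definition _ (F : finFieldType) (W : vectType F) :=
  isFinite.Build {vspace W}
    (pcan_enumP (can_pcan (@VectorInternalTheory.vs2mxK F W))).

Definition points (F : finFieldType) (W : vectType F) (U : {vspace W}) :
    {set {vspace W}} :=
  [set X : {vspace W} | (\dim X == 1%N) && (X <= U)%VS].

Notation vertices W := (points (fullv : {vspace W})).

Record qgraph (F : finFieldType) (W : vectType F) := QGraph {
  edges : {set {vspace W}};
  dim_edges : forall e : {vspace W}, e \in edges -> \dim e = 2%N }.

Section QGraph.
Variables (F : finFieldType) (W : vectType F).
Implicit Types (E : qgraph W) (X Y U T : {vspace W}) (B : {set {vspace W}}).

Definition adjacent E X Y : bool := (X + Y)%VS \in edges E.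

Definition nbhd E X : {set {vspace W}} :=
  [set Y in vertices W | (Y == X) || adjacent E X Y].

(* In a complete graph of dimension v >= 2 every neighborhood is the whole space,
   and mu is constrained by no pair of vertices.  With lambda = mu - 2 this forces
   mu to be the number of all vertices, whereas the set of neighborhoods has a
   single block: only the count with multiplicity gives mu. *)
Definition complete E : Prop :=
  forall X Y, X \in vertices W -> Y \in vertices W -> X != Y -> adjacent E X Y.

Definition regular E (k : nat) : Prop :=
  forall X, X \in vertices W -> exists2 U, nbhd E X = points U & \dim U = k.+1.

(* The parameters are integers so that lambda = mu - 2 is never truncated. *)
Definition strongly_regular E (k : nat) (lambda mu : int) : Prop :=
  regular E k /\
  forall X Y, X \in vertices W -> Y \in vertices W -> X != Y ->
    #|(nbhd E X :&: nbhd E Y) :\: [set X; Y]|%:Z =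
      if adjacent E X Y then lambda else mu.

Definition design (t k lambda : nat) B : Prop :=
  (forall U, U \in B -> \dim U = k) /\
  (forall T, \dim T = t -> #|[set U in B | (T <= U)%VS]| = lambda).

(* Designs with repeated blocks: m U is the multiplicity of the block U. *)
Definition multidesign (t k lambda : nat) (m : {vspace W} -> nat) : Prop :=
  (forall U, (0 < m U)%N -> \dim U = k) /\
  (forall T, \dim T = t -> (\sum_(U : {vspace W} | (T <= U)%VS) m U)%N = lambda).

(* A subspace U is identified with the set points U; this identification is
   injective, since U is spanned by its points. *)
Definition nbhd_blocks E : {set {vspace W}} :=
  [set U | [exists X in vertices W, nbhd E X == points U]].

Definition nbhd_mult E U : nat :=
  #|[set X in vertices W | nbhd E X == points U]|.

End QGraph.

(* Main.v *)
Require Import Defs.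
From mathcomp Require Import all_boot all_order all_algebra.
Set Implicit Arguments.
Unset Strict Implicit.
Unset Printing Implicit Defensive.
Import GRing.Theory.
Local Open Scope ring_scope.

(** The blocks through a plane [T = <X, Y>] are the neighborhoods [N(Z)] that
    contain [X] and [Y], because [N(Z)] is a subspace.  Adjacency is symmetric,
    so these are indexed by the vertices [Z] of [N(X) :&: N(Y)]
    ([nbhd_space_join]).  If [X] and [Y] are not adjacent, neither of them lies
    in this intersection, which therefore has [mu] elements; if they are
    adjacent, both lie in it, and it has [(mu - 2) + 2 = mu] elements as well
    ([card_nbhdI]).  Hence, counted with multiplicity, [mu] blocks pass through
    every [T].

    It remains to see that no block is repeated unless the graph is complete
    ([eq_nbhd_complete]).  If [N(X) = N(Y)] with [X != Y], then
    [mu = #|N(X) :&: N(Y)|] is the number of points of a whole neighborhood,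
    which is the same for all neighborhoods since they have the same dimension
    ([card_points_dim]).  Two non-adjacent vertices [X'] and [Y'] would then
    satisfy [N(X') :&: N(Y') = N(X')], although [X'] is not in [N(Y')]. *)

(** * Points of a subspace *)

Section Points.
Variables (F : finFieldType) (W : vectType F).
Implicit Types (X Y P T U : {vspace W}).

Lemma verticesE X : (X \in vertices W) = (\dim X == 1%N).
Proof. by rewrite inE subvf andbT. Qed.

(** The identification of subspaces with sets of points is faithful, because
    every nonzero vector of [U] spans one of its points. *)
Lemma sum_points U : (\sum_(P in points U) P)%VS = U.
Proof.
apply/eqP; rewrite eqEsubv; apply/andP; split.
  by apply/subv_sumP => P; rewrite inE => /andP[].
apply/subvP=> u uU; have [->|u0] := eqVneq u 0; first exact: mem0v.
rewrite memvE; apply: (sumv_sup <[u]>%VS) (subvv _).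
by rewrite inE dim_vline u0 -memvE.
Qed.

Lemma dim_join_vertices X Y :
  X \in vertices W -> Y \in vertices W -> X != Y -> \dim (X + Y)%VS = 2%N.
Proof.
rewrite !verticesE => /eqP dX /eqP dY neqXY.
suff dXY: \dim (X :&: Y)%VS = 0%N.
  by have := dimv_sum_cap X Y; rewrite dXY dX dY addn0.
apply/eqP; rewrite -leqn0 leqNgt; apply: contra neqXY => d_gt0.
(* a nonzero intersection of two lines through the origin is equal to both *)
have eqX: (X :&: Y)%VS = X by apply/eqP; rewrite eqEdim capvSl dX.
have eqY: (X :&: Y)%VS = Y by apply/eqP; rewrite eqEdim capvSr dY.
by rewrite -{1}eqX eqY.
Qed.

Lemma dim2_join T : \dim T = 2%N ->
  exists X Y, [/\ X \in vertices W, Y \in vertices W, X != Y & T = (X + Y)%VS].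
Proof.
move=> dT; have T0 : T != 0%VS by rewrite -dimv_eq0 dT.
pose X := <[vpick T]>%VS.
have XT : (X <= T)%VS by rewrite -memvE memv_pick.
have dX : \dim X = 1%N by rewrite dim_vline vpick0 T0.
have dY : \dim (T :\: X)%VS = 1%N.
  by have := dimv_cap_compl T X; rewrite (capv_idPr XT) dX dT => -[].
have defT : T = (X + (T :\: X))%VS by rewrite addvC addv_diff (addv_idPl XT).
exists X, (T :\: X)%VS; rewrite !verticesE dX dY; split=> //.
by apply/eqP=> eqXY; move: dT; rewrite defT -eqXY addvv dX.
Qed.

(** A linear map that sends a basis of [U1] to a basis of [U2] is injective on
    [U1], so it maps the points of [U1] injectively to points of [U2]. *)
Lemma leq_card_points_dim U1 U2 :
  \dim U1 = \dim U2 -> (#|points U1| <= #|points U2|)%N.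
Proof.
move=> eq_dim.
have [f0 def_f0] := linear_of_free (vbasis U1) (vbasis U2).
pose f := linfun f0.
have fU : (f @: U1)%VS = U2.
  rewrite -{1}(span_basis (vbasisP U1)) limg_span.
  rewrite (eq_map (lfunE f0)) def_f0 ?(basis_free (vbasisP U1)) ?size_tuple //.
  exact: span_basis (vbasisP U2).
have kf : (U1 :&: lker f = 0)%VS.
  apply/eqP; rewrite -dimv_eq0 -(eqn_add2r (\dim (f @: U1)%VS)).
  by rewrite limg_ker_dim fU add0n eq_dim.
have sub_preim P Q : (P <= U1)%VS -> (Q <= U1)%VS ->
    (f @: P <= f @: Q)%VS -> (P <= Q)%VS.
  move=> PU QU fPQ; apply/subvP=> p pP.
  have /memv_imgP[r rQ eqf] := subvP fPQ _ (memv_img f pP).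
  suff /eqP : p - r = 0 by rewrite subr_eq0 => /eqP->.
  apply/eqP; rewrite -memv0 -kf memv_cap memv_ker linearB /= eqf subrr eqxx andbT.
  by rewrite rpredB ?(subvP PU _ pP) ?(subvP QU _ rQ).
rewrite -(card_in_imset (f := fun P : {vspace W} => (f @: P)%VS)); last first.
  move=> P Q; rewrite !inE => /andP[_ PU] /andP[_ QU] eqPQ.
  by apply/eqP; rewrite eqEsubv; apply/andP; split; apply: sub_preim; rewrite ?eqPQ.
apply/subset_leq_card/subsetP=> _ /imsetP[P + ->]; rewrite !inE => /andP[dP PU].
rewrite -fU limgS // andbT limg_dim_eq //.
by apply/eqP; rewrite -subv0 -kf capvS.
Qed.

Lemma card_points_dim U1 U2 : \dim U1 = \dim U2 -> #|points U1| = #|points U2|.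
Proof. by move=> d; apply/eqP; rewrite eqn_leq !leq_card_points_dim. Qed.

End Points.

(** * Neighborhoods *)

Section Neighborhoods.
Variables (F : finFieldType) (W : vectType F) (E : qgraph W).
Implicit Types (X Y Z T U : {vspace W}).

Lemma adjacentC X Y : adjacent E X Y = adjacent E Y X.
Proof. by rewrite /adjacent addvC. Qed.

Lemma in_nbhd X Y :
  (Y \in nbhd E X) = (Y \in vertices W) && ((Y == X) || adjacent E X Y).
Proof. by rewrite !inE. Qed.

Lemma nbhd_refl X : X \in vertices W -> X \in nbhd E X.
Proof. by move=> VX; rewrite in_nbhd VX eqxx. Qed.

Lemma nbhd_sym X Y : X \in vertices W -> Y \in vertices W ->
  (Y \in nbhd E X) = (X \in nbhd E Y).
Proof. by move=> VX VY; rewrite !in_nbhd VX VY eq_sym adjacentC. Qed.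

(** Spanning makes the block of a vertex a total function of it, although
    regularity only asserts that the neighborhood is some subspace; the two
    agree by [sum_points]. *)
Definition nbhd_space X : {vspace W} := (\sum_(Y in nbhd E X) Y)%VS.

Section Regular.
Variable k : nat.
Hypothesis regE : regular E k.

Lemma points_nbhd_space X : X \in vertices W -> points (nbhd_space X) = nbhd E X.
Proof. by case/regE=> U defU _; rewrite /nbhd_space defU sum_points. Qed.

Lemma dim_nbhd_space X : X \in vertices W -> \dim (nbhd_space X) = k.+1.
Proof. by case/regE=> U defU dU; rewrite /nbhd_space defU sum_points. Qed.

Lemma nbhd_eq_points X U : X \in vertices W ->
  (nbhd E X == points U) = (nbhd_space X == U).
Proof.
move=> VX; apply/eqP/eqP => [defU | <-]; last by rewrite points_nbhd_space.
by rewrite /nbhd_space defU sum_points.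
Qed.

Lemma card_nbhd X Y : X \in vertices W -> Y \in vertices W ->
  #|nbhd E X| = #|nbhd E Y|.
Proof.
move=> VX VY; rewrite -!points_nbhd_space //.
by apply: card_points_dim; rewrite !dim_nbhd_space.
Qed.

Lemma nbhd_multE U :
  nbhd_mult E U = #|[set X in vertices W | nbhd_space X == U]|.
Proof.
apply: eq_card => X; rewrite [LHS]in_set [RHS]in_set.
by have [VX /= | //] := boolP (X \in vertices W); rewrite nbhd_eq_points.
Qed.

Lemma nbhd_blocksE : nbhd_blocks E = nbhd_space @: vertices W.
Proof.
apply/setP=> U; rewrite inE; apply/exists_inP/imsetP => -[X VX].
  by rewrite nbhd_eq_points // => /eqP<-; exists X.
by move=> ->; exists X; rewrite ?nbhd_eq_points.
Qed.

Lemma sum_nbhd_mult T :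
  (\sum_(U : {vspace W} | (T <= U)%VS) nbhd_mult E U)%N
    = #|[set Z in vertices W | (T <= nbhd_space Z)%VS]|.
Proof.
rewrite -sum1dep_card.
rewrite [RHS](partition_big nbhd_space (fun U => T <= U)%VS) /=; last by move=> Z /andP[].
apply: eq_bigr => U TU; rewrite nbhd_multE -sum1dep_card; apply: eq_bigl => Z.
by case: eqP => [->|]; rewrite ?TU ?andbT ?andbF.
Qed.

Lemma nbhd_space_join X Y : X \in vertices W -> Y \in vertices W ->
  [set Z in vertices W | (X + Y <= nbhd_space Z)%VS] = nbhd E X :&: nbhd E Y.
Proof.
move=> VX VY; apply/setP=> Z; rewrite in_setI in_set.
have [VZ | nVZ] /= := boolP (Z \in vertices W); last first.
  by rewrite in_nbhd (negPf nVZ).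
rewrite subv_add !(nbhd_sym _ VZ) // -(points_nbhd_space VZ) !inE.
by move: VX VY; rewrite !verticesE => -> ->.
Qed.

End Regular.

(** * Strong regularity with lambda = mu - 2 *)

Section StronglyRegular.
Variables k mu : nat.
Hypothesis srgE : strongly_regular E k (mu%:Z - 2) mu%:Z.
Let regE : regular E k := proj1 srgE.

Lemma card_nbhdI X Y : X \in vertices W -> Y \in vertices W -> X != Y ->
  #|nbhd E X :&: nbhd E Y| = mu.
Proof.
move=> VX VY neqXY; have := proj2 srgE X Y VX VY neqXY.
rewrite cardsD.
have [adjXY | nadjXY] := boolP (adjacent E X Y).
  (* adjacent vertices are both among their common neighbors *)
  have sXY : [set X; Y] \subset nbhd E X :&: nbhd E Y.
    by apply/subsetP=> Z; rewrite in_setI !in_nbhd in_set2 => /orP[] /eqP->;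
      rewrite ?VX ?VY eqxx ?adjXY ?(adjacentC Y) ?adjXY ?orbT.
  rewrite (setIidPr sXY) cards2 neqXY /=.
  have /= := subset_leq_card sXY; rewrite cards2 neqXY /= => le2.
  by rewrite -subzn // => /addIr[].
(* non-adjacent vertices are not among their common neighbors *)
have -> : nbhd E X :&: nbhd E Y :&: [set X; Y] = set0.
  apply/setP=> Z; rewrite in_setI in_setI in_set2 in_set0 !in_nbhd.
  apply/negbTE; apply/negP => /andP[/andP[/andP[_ hX] /andP[_ hY]] /orP[] /eqP defZ].
    by move: hY; rewrite defZ (negPf neqXY) adjacentC (negPf nadjXY).
  by move: hX; rewrite defZ eq_sym (negPf neqXY) (negPf nadjXY).
by rewrite cards0 subn0 => -[].
Qed.

(** Equal neighborhoods make [mu] as large as a neighborhood, which leaves no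
    room for a pair of non-adjacent vertices: each is missing from the
    neighborhood of the other. *)
Lemma eq_nbhd_complete X Y : X \in vertices W -> Y \in vertices W -> X != Y ->
  nbhd E X = nbhd E Y -> complete E.
Proof.
move=> VX VY neqXY eqN X' Y' VX' VY' neqXY'.
have cardN : #|nbhd E X'| = mu.
  by rewrite (card_nbhd regE VX' VX) -(card_nbhdI VX VY neqXY) -eqN setIid.
have : nbhd E X' :&: nbhd E Y' == nbhd E X'.
  by rewrite eqEcard subsetIl cardN card_nbhdI /=.
move/eqP/setP/(_ X'); rewrite in_setI nbhd_refl //= in_nbhd (negPf neqXY').
by rewrite adjacentC => /andP[].
Qed.

Lemma nbhd_multidesign : multidesign 2 k.+1 mu (nbhd_mult E).
Proof.
split=> [U | T dT].
  rewrite (nbhd_multE regE) card_gt0 => /set0Pn[X].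
  by rewrite in_set => /andP[VX /eqP<-]; exact: dim_nbhd_space.
have [X [Y [VX VY neqXY ->]]] := dim2_join dT.
by rewrite (sum_nbhd_mult regE) (nbhd_space_join regE) // card_nbhdI.
Qed.

Lemma nbhd_design : {in vertices W &, injective (nbhd E)} ->
  design 2 k.+1 mu (nbhd_blocks E).
Proof.
move=> injN.
have injS : {in vertices W &, injective nbhd_space}.
  move=> X Y VX VY eqS; apply: injN => //.
  by rewrite -!(points_nbhd_space regE) // eqS.
rewrite (nbhd_blocksE regE); split=> [_ /imsetP[X VX ->] | T dT].
  exact: dim_nbhd_space.
have [_ /(_ T dT) <-] := nbhd_multidesign; rewrite (sum_nbhd_mult regE).
rewrite -[RHS](card_in_imset (f := nbhd_space)); last first.
  by apply: sub_in2 injS => Z; rewrite in_set => /andP[].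
apply: eq_card => U; rewrite in_set; apply/andP/imsetP.
  by case=> /imsetP[X VX ->] TU; exists X; rewrite // in_set VX.
by case=> X; rewrite in_set => /andP[VX TX] ->; split=> //; apply: imset_f.
Qed.

End StronglyRegular.
End Neighborhoods.

Theorem theorem3p15 (F : finFieldType) (v k mu : nat)
    (E : qgraph 'rV[F]_v)
    (hE : strongly_regular E k (mu%:Z - 2) mu%:Z) :
  multidesign 2 k.+1 mu (nbhd_mult E) /\
  (((1 < v)%N -> ~ complete E) -> design 2 k.+1 mu (nbhd_blocks E)).
Proof.
split=> [|ncomplE]; first exact: nbhd_multidesign hE.
apply: (nbhd_design hE) => X Y VX VY eqN; apply/eqP; apply/negP => /negP neqXY.
apply: ncomplE (eq_nbhd_complete hE VX VY neqXY eqN).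
(* two distinct points span a plane, so the ambient space has dimension > 1 *)
rewrite -(dim_join_vertices VX VY neqXY) (leq_trans (dimvS (subvf _))) //.
by rewrite dimvf /dim /= mul1n.
Qed.
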